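(* Let $(\mathcal{T},\varphi,\psi)$ be a bimonoidal monad on a duoidal category $(\mathsf{C},\diamond,I,\star,J)$. Assume that universal $(\mathcal{T},\varphi)$-multilinear maps in $(\mathsf{C},\diamond)$ exist for all finite sequences of $\mathcal{T}$-algebras and that they are closed under composition, and let $\diamond^{\varphi}$ be the resulting monoidal structure on $\mathsf{C}^{\mathcal{T}}$, with unit $\mathcal{T}I$. Then, with the interchange law $\zeta^{\mathcal{T}}$ and unit maps described in the context, $(\mathsf{C}^{\mathcal{T}},\diamond^{\varphi},\mathcal{T}I,\star,J)$ is a duoidal category.
   Context: Monoidal categories are treated as if strict. **Duoidal category.** A category $\mathsf{C}$ with two monoidal structures $(\diamond,I)$, $(\star,J)$, a natural transformation (interchange law) $\zeta_{A,B,C,D}:(A\star B)\diamond(C\star D)\to(A\diamond C)\star(B\diamond D)$ and unit maps $\delta:I\to I\star I$, $\theta:J\diamond J\to J$, $\zeta_0:I\to J$ such that: $\zeta(\zeta\diamond\mathrm{id})=\zeta(\mathrm{id}\diamond\zeta)$ as maps $(A\star X)\diamond(B\star Y)\diamond(C\star Z)\to(A\diamond B\diamond C)\star(X\diamond Y\diamond Z)$; $(\zeta\star\mathrm{id})\zeta=(\mathrm{id}\star\zeta)\zeta$ as maps $(A\star B\star C)\diamond(X\star Y\star Z)\to(A\diamond X)\star(B\diamond Y)\star(C\diamond Z)$; the composites $A\star B=I\diamond(A\star B)\xrightarrow{\delta\diamond\mathrm{id}}(I\star I)\diamond(A\star B)\xrightarrow{\zeta}(I\diamond A)\star(I\diamond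 B)=A\star B$ and $A\diamond B=(J\star A)\diamond(J\star B)\xrightarrow{\zeta}(J\diamond J)\star(A\diamond B)\xrightarrow{\theta\star\mathrm{id}}J\star(A\diamond B)=A\diamond B$, and their right-handed versions, are identities; $(J,\theta,\zeta_0)$ is a monoid in $(\mathsf{C},\diamond,I)$; $(I,\delta,\zeta_0)$ is a comonoid in $(\mathsf{C},\star,J)$. **Monoidal and comonoidal monads.** A monad $(\mathcal{T},\mu,\eta)$ on a monoidal category is monoidal (resp. comonoidal) if the functor $\mathcal{T}$ carries a lax (resp. colax) monoidal structure for which $\mu$ and $\eta$ are morphisms of monoidal (resp. comonoidal) functors. **Bimonoidal monad.** A monad $\mathcal{T}$ on $\mathsf{C}$ with structures $\varphi_{X,Y}:\mathcal{T}X\diamond\mathcal{T}Y\to\mathcal{T}(X\diamond Y)$, $\varphi_0:I\to\mathcal{T}I$ making it monoidal on $(\mathsf{C},\diamond,I)$, and $\psi_{X,Y}:\mathcal{T}(X\star Y)\to\mathcal{T}X\star\mathcal{T}Y$, $\psi_0:\mathcal{T}J\to J$ making it comonoidal on $(\mathsf{C},\star,J)$, such that $(\varphi\star\varphi)\circ\zeta\circ(\psi\diamond\psi)=\psi\circ\mathcal{T}\zeta\circ\varphi$ as maps $\mathcal{T}(A\star B)\diamond\mathcal{T}(C\star D)\to\mathcal{T}(A\diamond C)\star\mathcal{T}(B\diamond D)$; $\psi_{I,I}\circ\mathcal{T}\delta\circ\varphi_0=(\varphi_0\star\varphi_0)\circ\delta$; $\psi_0\circ\mathcal{T}\theta\circ\varphi_{J,J}=\theta\circ(\psi_0\diamond\psi_0)$;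 $\psi_0\circ\mathcal{T}\zeta_0\circ\varphi_0=\zeta_0$. **Multilinearity.** For $\mathcal{T}$-algebras $(V_i,v_i)$, $(W,w)$, a map $f:V_1\diamond\cdots\diamond V_n\to W$ in $\mathsf{C}$ is $(\mathcal{T},\varphi)$-multilinear if $w\circ\mathcal{T}f\circ\varphi=f\circ(v_1\diamond\cdots\diamond v_n)$, where $\varphi:\mathcal{T}V_1\diamond\cdots\diamond\mathcal{T}V_n\to\mathcal{T}(V_1\diamond\cdots\diamond V_n)$ is the iterated structure map ($\varphi_0$ if $n=0$). A multilinear map $u$ is universal if every multilinear map with the same domain sequence of algebras factors uniquely as a morphism of algebras after $u$. Closed under composition means: if $a_1,\dots,a_n$ are universal with codomains $V_1,\dots,V_n$ and $b:V_1\diamond\cdots\diamond V_n\to W$ is universal, then $b\circ(a_1\diamond\cdots\diamond a_n)$ is universal. Write $u_{A_1,\dots,A_n}:A_1\diamond\cdots\diamond A_n\to A_1\diamond^{\varphi}\cdots\diamond^{\varphi}A_n$ for the universal multilinear maps; under the assumptions these define a monoidal structure $\diamond^{\varphi}$ on $\mathsf{C}^{\mathcal{T}}$ with unit the free algebra $\mathcal{T}I$ (the universal $0$-linear map being $\varphi_0:I\to\mathcal{T}I$). **The structure $\star$ on $\mathsf{C}^{\mathcal{T}}$.** For algebras $(X,x)$, $(Y,y)$, $X\star Y$ is an algebra via $(x\star y)\circ\psi_{X,Y}$, and $J$ is an algebra via $\psi_0$. **Interchange law and unit maps on $\mathsf{C}^{\mathcal{T}}$.** For algebras $A,B,C,D$,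 $(u_{A,C}\star u_{B,D})\circ\zeta_{A,B,C,D}$ is $(\mathcal{T},\varphi)$-bilinear, and $\zeta^{\mathcal{T}}_{A,B,C,D}:(A\star B)\diamond^{\varphi}(C\star D)\to(A\diamond^{\varphi}C)\star(B\diamond^{\varphi}D)$ is the unique algebra morphism with $\zeta^{\mathcal{T}}\circ u=(u\star u)\circ\zeta$. The unit maps are: the unique algebra morphism $J\diamond^{\varphi}J\to J$ whose composite with $u_{J,J}$ is $\theta$; $\mathcal{T}I\xrightarrow{\mathcal{T}\delta}\mathcal{T}(I\star I)\xrightarrow{\psi_{I,I}}\mathcal{T}I\star\mathcal{T}I$; and $\mathcal{T}I\xrightarrow{\mathcal{T}\zeta_0}\mathcal{T}J\xrightarrow{\psi_0}J$. *)

(* Defs.v *)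
From Stdlib Require Import List ProofIrrelevance.
Import ListNotations.

Record Category := {
  Ob :> Type;
  Hom : Ob -> Ob -> Type;
  idm : forall A, Hom A A;
  comp : forall A B D, Hom B D -> Hom A B -> Hom A D;
  comp_id_l : forall A B (f : Hom A B), comp A B B (idm B) f = f;
  comp_id_r : forall A B (f : Hom A B), comp A A B f (idm A) = f;
  comp_assoc : forall A B D E (h : Hom D E) (g : Hom B D) (f : Hom A B),
    comp A D E h (comp A B D g f) = comp A B E (comp B D E h g) f
}.
Arguments Hom {c} _ _.
Arguments idm {c} _.
Arguments comp {c A B D} _ _.
Arguments comp_id_l {c A B} _.
Arguments comp_id_r {c A B} _.
Arguments comp_assoc {c A B D E} _ _ _.
Notation "g ∘ f" := (comp g f) (at level 40, left associativity).

Record Functor (C D : Category) := {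
  fobj :> C -> D;
  fmap : forall A B : C, Hom A B -> Hom (fobj A) (fobj B);
  fmap_id : forall A : C, fmap A A (idm A) = idm (fobj A);
  fmap_comp : forall (A B E : C) (g : Hom B E) (f : Hom A B),
    fmap A E (g ∘ f) = fmap B E g ∘ fmap A B f
}.
Arguments fobj {C D} _ _.
Arguments fmap {C D} _ {A B} _.
Arguments fmap_id {C D} _ _.
Arguments fmap_comp {C D} _ {A B E} _ _.

Record Monad (C : Category) := {
  monad_functor :> Functor C C;
  mu : forall A : C, Hom (monad_functor (monad_functor A)) (monad_functor A);
  eta : forall A : C, Hom A (monad_functor A);
  mu_nat : forall (A B : C) (f : Hom A B),
    mu B ∘ fmap monad_functor (fmap monad_functor f) = fmap monad_functor f ∘ mu A;
  eta_nat : forall (A B : C) (f : Hom A B),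
    eta B ∘ f = fmap monad_functor f ∘ eta A;
  mu_assoc : forall A : C,
    mu A ∘ fmap monad_functor (mu A) = mu A ∘ mu (monad_functor A);
  mu_eta_l : forall A : C, mu A ∘ eta (monad_functor A) = idm _;
  mu_eta_r : forall A : C, mu A ∘ fmap monad_functor (eta A) = idm _
}.
Arguments monad_functor {C} _.
Arguments mu {C} _ _.
Arguments eta {C} _ _.
Arguments mu_nat {C} _ {A B} _.
Arguments eta_nat {C} _ {A B} _.
Arguments mu_assoc {C} _ _.
Arguments mu_eta_l {C} _ _.
Arguments mu_eta_r {C} _ _.

(** Monoidal categories are not assumed strict: every identification that
    strictness would provide is an explicit associator or unitor.  The tensor
    of objects and the unit are parameters, so that [Monoidal ten e] reads
    "a monoidal structure with tensor [ten] and unit [e]". *)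
Record Monoidal {C : Category} (ten : C -> C -> C) (e : C) := {
  tmap : forall A A' B B' : C,
    Hom A A' -> Hom B B' -> Hom (ten A B) (ten A' B');
  tmap_id : forall A B : C, tmap A A B B (idm A) (idm B) = idm (ten A B);
  tmap_comp : forall (A A' A'' B B' B'' : C)
      (f' : Hom A' A'') (f : Hom A A') (g' : Hom B' B'') (g : Hom B B'),
    tmap A A'' B B'' (f' ∘ f) (g' ∘ g)
    = tmap A' A'' B' B'' f' g' ∘ tmap A A' B B' f g;

  assoc : forall X Y Z : C, Hom (ten (ten X Y) Z) (ten X (ten Y Z));
  assoc_inv : forall X Y Z : C, Hom (ten X (ten Y Z)) (ten (ten X Y) Z);
  assocK : forall X Y Z : C, assoc_inv X Y Z ∘ assoc X Y Z = idm _;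
  assoc_invK : forall X Y Z : C, assoc X Y Z ∘ assoc_inv X Y Z = idm _;
  assoc_nat : forall (X X' Y Y' Z Z' : C)
      (f : Hom X X') (g : Hom Y Y') (h : Hom Z Z'),
    assoc X' Y' Z' ∘ tmap _ _ _ _ (tmap _ _ _ _ f g) h
    = tmap _ _ _ _ f (tmap _ _ _ _ g h) ∘ assoc X Y Z;

  lunit : forall X : C, Hom (ten e X) X;
  lunit_inv : forall X : C, Hom X (ten e X);
  lunitK : forall X : C, lunit_inv X ∘ lunit X = idm _;
  lunit_invK : forall X : C, lunit X ∘ lunit_inv X = idm _;
  lunit_nat : forall (X X' : C) (f : Hom X X'),
    lunit X' ∘ tmap _ _ _ _ (idm e) f = f ∘ lunit X;

  runit : forall X : C, Hom (ten X e) X;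
  runit_inv : forall X : C, Hom X (ten X e);
  runitK : forall X : C, runit_inv X ∘ runit X = idm _;
  runit_invK : forall X : C, runit X ∘ runit_inv X = idm _;
  runit_nat : forall (X X' : C) (f : Hom X X'),
    runit X' ∘ tmap _ _ _ _ f (idm e) = f ∘ runit X;

  pentagon : forall W X Y Z : C,
    tmap _ _ _ _ (idm W) (assoc X Y Z)
      ∘ (assoc W (ten X Y) Z ∘ tmap _ _ _ _ (assoc W X Y) (idm Z))
    = assoc W X (ten Y Z) ∘ assoc (ten W X) Y Z;
  triangle : forall X Y : C,
    tmap _ _ _ _ (idm X) (lunit Y) ∘ assoc X e Y
    = tmap _ _ _ _ (runit X) (idm Y)
}.
Arguments tmap {C ten e} _ {A A' B B'} _ _.
Arguments tmap_id {C ten e} _ _ _.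
Arguments tmap_comp {C ten e} _ {A A' A'' B B' B''} _ _ _ _.
Arguments assoc {C ten e} _ _ _ _.
Arguments assoc_inv {C ten e} _ _ _ _.
Arguments assocK {C ten e} _ _ _ _.
Arguments assoc_invK {C ten e} _ _ _ _.
Arguments assoc_nat {C ten e} _ {X X' Y Y' Z Z'} _ _ _.
Arguments lunit {C ten e} _ _.
Arguments lunit_inv {C ten e} _ _.
Arguments lunitK {C ten e} _ _.
Arguments lunit_invK {C ten e} _ _.
Arguments lunit_nat {C ten e} _ {X X'} _.
Arguments runit {C ten e} _ _.
Arguments runit_inv {C ten e} _ _.
Arguments runitK {C ten e} _ _.
Arguments runit_invK {C ten e} _ _.
Arguments runit_nat {C ten e} _ {X X'} _.
Arguments pentagon {C ten e} _ _ _ _ _.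
Arguments triangle {C ten e} _ _ _.

Notation "f ⊗[ M ] g" := (tmap M f g)
  (at level 39, M at level 200, no associativity,
   format "f  ⊗[ M ]  g").

Lemma tmap_comp_l {C : Category} {ten : C -> C -> C} {e : C} (M : Monoidal ten e)
  (X Y Z A B : C) (g : Hom Y Z) (h : Hom X Y) (f : Hom A B) :
  (g ∘ h) ⊗[M] f = (g ⊗[M] f) ∘ (h ⊗[M] idm A).
Proof. now rewrite <- tmap_comp, comp_id_r. Qed.

Lemma tmap_comp_r {C : Category} {ten : C -> C -> C} {e : C} (M : Monoidal ten e)
  (X Y Z A B : C) (f : Hom A B) (g : Hom Y Z) (h : Hom X Y) :
  f ⊗[M] (g ∘ h) = (f ⊗[M] g) ∘ (idm A ⊗[M] h).
Proof. now rewrite <- tmap_comp, comp_id_r. Qed.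

Record is_monoid {C : Category} {ten : C -> C -> C} {e : C}
    (M : Monoidal ten e) (X : C) (m : Hom (ten X X) X) (i : Hom e X) : Prop := {
  monoid_assoc : m ∘ (m ⊗[M] idm X) = m ∘ (idm X ⊗[M] m) ∘ assoc M X X X;
  monoid_unit_l : m ∘ (i ⊗[M] idm X) = lunit M X;
  monoid_unit_r : m ∘ (idm X ⊗[M] i) = runit M X
}.

Record is_comonoid {C : Category} {ten : C -> C -> C} {e : C}
    (M : Monoidal ten e) (X : C) (d : Hom X (ten X X)) (c : Hom X e) : Prop := {
  comonoid_assoc : assoc M X X X ∘ (d ⊗[M] idm X) ∘ d = (idm X ⊗[M] d) ∘ d;
  comonoid_unit_l : lunit M X ∘ (c ⊗[M] idm X) ∘ d = idm X;
  comonoid_unit_r : runit M X ∘ (idm X ⊗[M] c) ∘ d = idm X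
}.

Section Duoidal.
Context {C : Category} {dia : C -> C -> C} {I : C} {star : C -> C -> C} {J : C}.
Context (MD : Monoidal dia I) (MS : Monoidal star J).
Local Notation "A ⋄ B" := (dia A B) (at level 39, no associativity).
Local Notation "A ⋆ B" := (star A B) (at level 39, no associativity).
Local Notation "f [⋄] g" := (tmap MD f g) (at level 39, no associativity).
Local Notation "f [⋆] g" := (tmap MS f g) (at level 39, no associativity).

Record Duoidal := {
  zeta : forall A B A' B' : C, Hom ((A ⋆ B) ⋄ (A' ⋆ B')) ((A ⋄ A') ⋆ (B ⋄ B'));
  delta : Hom I (I ⋆ I);
  theta : Hom (J ⋄ J) J;
  zeta0 : Hom I J;

  zeta_nat : forall (A A1 B B1 A' A1' B' B1' : C)
      (f : Hom A A1) (g : Hom B B1) (f' : Hom A' A1') (g' : Hom B' B1'),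
    zeta A1 B1 A1' B1' ∘ ((f [⋆] g) [⋄] (f' [⋆] g'))
    = ((f [⋄] f') [⋆] (g [⋄] g')) ∘ zeta A B A' B';

  zeta_assoc_dia : forall A X B Y D Z : C,
    (assoc MD A B D [⋆] assoc MD X Y Z)
      ∘ zeta (A ⋄ B) (X ⋄ Y) D Z
      ∘ (zeta A X B Y [⋄] idm (D ⋆ Z))
    = zeta A X (B ⋄ D) (Y ⋄ Z)
      ∘ (idm (A ⋆ X) [⋄] zeta B Y D Z)
      ∘ assoc MD (A ⋆ X) (B ⋆ Y) (D ⋆ Z);

  zeta_assoc_star : forall A B D X Y Z : C,
    assoc MS (A ⋄ X) (B ⋄ Y) (D ⋄ Z)
      ∘ (zeta A B X Y [⋆] idm (D ⋄ Z))
      ∘ zeta (A ⋆ B) D (X ⋆ Y) Z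
    = (idm (A ⋄ X) [⋆] zeta B D Y Z)
      ∘ zeta A (B ⋆ D) X (Y ⋆ Z)
      ∘ (assoc MS A B D [⋄] assoc MS X Y Z);

  zeta_delta_l : forall A B : C,
    (lunit MD A [⋆] lunit MD B) ∘ zeta I I A B ∘ (delta [⋄] idm (A ⋆ B))
    = lunit MD (A ⋆ B);
  zeta_delta_r : forall A B : C,
    (runit MD A [⋆] runit MD B) ∘ zeta A B I I ∘ (idm (A ⋆ B) [⋄] delta)
    = runit MD (A ⋆ B);

  zeta_theta_l : forall A B : C,
    lunit MS (A ⋄ B) ∘ (theta [⋆] idm (A ⋄ B)) ∘ zeta J A J B
    = lunit MS A [⋄] lunit MS B;
  zeta_theta_r : forall A B : C,
    runit MS (A ⋄ B) ∘ (idm (A ⋄ B) [⋆] theta) ∘ zeta A J B J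
    = runit MS A [⋄] runit MS B;

  J_monoid : is_monoid MD J theta zeta0;
  I_comonoid : is_comonoid MS I delta zeta0
}.
End Duoidal.
Arguments zeta {C dia I star J MD MS} _ _ _ _ _.
Arguments delta {C dia I star J MD MS} _.
Arguments theta {C dia I star J MD MS} _.
Arguments zeta0 {C dia I star J MD MS} _.
Arguments zeta_nat {C dia I star J MD MS} _ {A A1 B B1 A' A1' B' B1'} _ _ _ _.
Arguments zeta_assoc_dia {C dia I star J MD MS} _ _ _ _ _ _ _.
Arguments zeta_assoc_star {C dia I star J MD MS} _ _ _ _ _ _ _.
Arguments zeta_delta_l {C dia I star J MD MS} _ _ _.
Arguments zeta_delta_r {C dia I star J MD MS} _ _ _.
Arguments zeta_theta_l {C dia I star J MD MS} _ _ _.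
Arguments zeta_theta_r {C dia I star J MD MS} _ _ _.
Arguments J_monoid {C dia I star J MD MS} _.
Arguments I_comonoid {C dia I star J MD MS} _.

Record LaxMonoidal {C : Category} {ten : C -> C -> C} {e : C}
    (M : Monoidal ten e) (F : Functor C C) := {
  phi : forall X Y : C, Hom (ten (F X) (F Y)) (F (ten X Y));
  phi0 : Hom e (F e);
  phi_nat : forall (X X' Y Y' : C) (f : Hom X X') (g : Hom Y Y'),
    phi X' Y' ∘ (fmap F f ⊗[M] fmap F g) = fmap F (f ⊗[M] g) ∘ phi X Y;
  phi_assoc : forall X Y Z : C,
    fmap F (assoc M X Y Z) ∘ phi (ten X Y) Z ∘ (phi X Y ⊗[M] idm (F Z))
    = phi X (ten Y Z) ∘ (idm (F X) ⊗[M] phi Y Z) ∘ assoc M (F X) (F Y) (F Z);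
  phi_unit_l : forall X : C,
    fmap F (lunit M X) ∘ phi e X ∘ (phi0 ⊗[M] idm (F X)) = lunit M (F X);
  phi_unit_r : forall X : C,
    fmap F (runit M X) ∘ phi X e ∘ (idm (F X) ⊗[M] phi0) = runit M (F X)
}.
Arguments phi {C ten e M F} _ _ _.
Arguments phi0 {C ten e M F} _.
Arguments phi_nat {C ten e M F} _ {X X' Y Y'} _ _.
Arguments phi_assoc {C ten e M F} _ _ _ _.
Arguments phi_unit_l {C ten e M F} _ _.
Arguments phi_unit_r {C ten e M F} _ _.

Record ColaxMonoidal {C : Category} {ten : C -> C -> C} {e : C}
    (M : Monoidal ten e) (F : Functor C C) := {
  psi : forall X Y : C, Hom (F (ten X Y)) (ten (F X) (F Y));
  psi0 : Hom (F e) e;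
  psi_nat : forall (X X' Y Y' : C) (f : Hom X X') (g : Hom Y Y'),
    psi X' Y' ∘ fmap F (f ⊗[M] g) = (fmap F f ⊗[M] fmap F g) ∘ psi X Y;
  psi_assoc : forall X Y Z : C,
    assoc M (F X) (F Y) (F Z) ∘ (psi X Y ⊗[M] idm (F Z)) ∘ psi (ten X Y) Z
    = (idm (F X) ⊗[M] psi Y Z) ∘ psi X (ten Y Z) ∘ fmap F (assoc M X Y Z);
  psi_unit_l : forall X : C,
    lunit M (F X) ∘ (psi0 ⊗[M] idm (F X)) ∘ psi e X = fmap F (lunit M X);
  psi_unit_r : forall X : C,
    runit M (F X) ∘ (idm (F X) ⊗[M] psi0) ∘ psi X e = fmap F (runit M X)
}.
Arguments psi {C ten e M F} _ _ _.
Arguments psi0 {C ten e M F} _.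
Arguments psi_nat {C ten e M F} _ {X X' Y Y'} _ _.
Arguments psi_assoc {C ten e M F} _ _ _ _.
Arguments psi_unit_l {C ten e M F} _ _.
Arguments psi_unit_r {C ten e M F} _ _.

(** The composite [T T] carries the structure [fmap T phi ∘ phi],
    [fmap T phi0 ∘ phi0]; dually for the colax case. *)
Record MonoidalMonad {C : Category} {ten : C -> C -> C} {e : C}
    (M : Monoidal ten e) (T : Monad C) := {
  mm_lax :> LaxMonoidal M T;
  eta_phi : forall X Y : C,
    phi mm_lax X Y ∘ (eta T X ⊗[M] eta T Y) = eta T (ten X Y);
  eta_phi0 : phi0 mm_lax = eta T e;
  mu_phi : forall X Y : C,
    phi mm_lax X Y ∘ (mu T X ⊗[M] mu T Y)
    = mu T (ten X Y) ∘ (fmap T (phi mm_lax X Y) ∘ phi mm_lax (T X) (T Y));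
  mu_phi0 : phi0 mm_lax = mu T e ∘ (fmap T (phi0 mm_lax) ∘ phi0 mm_lax)
}.
Arguments mm_lax {C ten e M T} _.
Arguments eta_phi {C ten e M T} _ _ _.
Arguments eta_phi0 {C ten e M T} _.
Arguments mu_phi {C ten e M T} _ _ _.
Arguments mu_phi0 {C ten e M T} _.

Record ComonoidalMonad {C : Category} {ten : C -> C -> C} {e : C}
    (M : Monoidal ten e) (T : Monad C) := {
  cm_colax :> ColaxMonoidal M T;
  eta_psi : forall X Y : C,
    psi cm_colax X Y ∘ eta T (ten X Y) = eta T X ⊗[M] eta T Y;
  eta_psi0 : psi0 cm_colax ∘ eta T e = idm e;
  mu_psi : forall X Y : C,
    psi cm_colax X Y ∘ mu T (ten X Y)
    = (mu T X ⊗[M] mu T Y) ∘ (psi cm_colax (T X) (T Y) ∘ fmap T (psi cm_colax X Y));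
  mu_psi0 : psi0 cm_colax ∘ mu T e = psi0 cm_colax ∘ fmap T (psi0 cm_colax)
}.
Arguments cm_colax {C ten e M T} _.
Arguments eta_psi {C ten e M T} _ _ _.
Arguments eta_psi0 {C ten e M T} _.
Arguments mu_psi {C ten e M T} _ _ _.
Arguments mu_psi0 {C ten e M T} _.

Record BimonoidalMonad {C : Category} {dia : C -> C -> C} {I : C}
    {star : C -> C -> C} {J : C} {MD : Monoidal dia I} {MS : Monoidal star J}
    (D : Duoidal MD MS) (T : Monad C) := {
  bm_phi : MonoidalMonad MD T;
  bm_psi : ComonoidalMonad MS T;
  bm_zeta : forall A B A' B' : C,
    (phi bm_phi A A' ⊗[MS] phi bm_phi B B')
      ∘ zeta D (T A) (T B) (T A') (T B')
      ∘ (psi bm_psi A B ⊗[MD] psi bm_psi A' B')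
    = psi bm_psi (dia A A') (dia B B')
      ∘ fmap T (zeta D A B A' B')
      ∘ phi bm_phi (star A B) (star A' B');
  bm_delta :
    psi bm_psi I I ∘ fmap T (delta D) ∘ phi0 bm_phi
    = (phi0 bm_phi ⊗[MS] phi0 bm_phi) ∘ delta D;
  bm_theta :
    psi0 bm_psi ∘ fmap T (theta D) ∘ phi bm_phi J J
    = theta D ∘ (psi0 bm_psi ⊗[MD] psi0 bm_psi);
  bm_zeta0 : psi0 bm_psi ∘ fmap T (zeta0 D) ∘ phi0 bm_phi = zeta0 D
}.
Arguments bm_phi {C dia I star J MD MS D T} _.
Arguments bm_psi {C dia I star J MD MS D T} _.
Arguments bm_zeta {C dia I star J MD MS D T} _ _ _ _ _.
Arguments bm_delta {C dia I star J MD MS D T} _.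
Arguments bm_theta {C dia I star J MD MS D T} _.
Arguments bm_zeta0 {C dia I star J MD MS D T} _.

Record Algebra {C : Category} (T : Monad C) := {
  carrier :> C;
  act : Hom (T carrier) carrier;
  act_eta : act ∘ eta T carrier = idm carrier;
  act_mu : act ∘ mu T carrier = act ∘ fmap T act
}.
Arguments carrier {C T} _.
Arguments act {C T} _.
Arguments act_eta {C T} _.
Arguments act_mu {C T} _.

Record AlgHom {C : Category} {T : Monad C} (A B : Algebra T) := {
  und : Hom (carrier A) (carrier B);
  und_act : act B ∘ fmap T und = und ∘ act A
}.
Arguments und {C T A B} _.
Arguments und_act {C T A B} _.

Lemma alghom_eq {C : Category} {T : Monad C} (A B : Algebra T) (f g : AlgHom A B) :
  und f = und g -> f = g.
Proof.
destruct f as [f Hf], g as [g Hg]; simpl; intros E; subst g.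
f_equal; apply proof_irrelevance.
Qed.

Definition alg_id {C : Category} {T : Monad C} (A : Algebra T) : AlgHom A A.
Proof.
exists (idm A).
abstract (now rewrite fmap_id, comp_id_l, comp_id_r).
Defined.

Definition alg_comp {C : Category} {T : Monad C} (A B D : Algebra T)
  (g : AlgHom B D) (f : AlgHom A B) : AlgHom A D.
Proof.
exists (und g ∘ und f).
abstract (now rewrite fmap_comp, comp_assoc, und_act, <- comp_assoc, und_act,
            comp_assoc).
Defined.

Definition EM {C : Category} (T : Monad C) : Category.
Proof.
refine {| Ob := Algebra T; Hom := AlgHom; idm := alg_id; comp := alg_comp |};
abstract (intros; apply alghom_eq; simpl;
          auto using comp_id_l, comp_id_r, comp_assoc).
Defined.

Definition free_alg {C : Category} (T : Monad C) (X : C) : Algebra T :=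
  {| carrier := T X; act := mu T X;
     act_eta := mu_eta_l T X; act_mu := eq_sym (mu_assoc T X) |}.

Section StarAlgebras.
Context {C : Category} {star : C -> C -> C} {J : C} {MS : Monoidal star J}.
Context {T : Monad C} (S : ComonoidalMonad MS T).

Definition star_alg (X Y : Algebra T) : Algebra T.
Proof.
refine {| carrier := star X Y; act := (act X ⊗[MS] act Y) ∘ psi S X Y |}.
- abstract (now rewrite <- comp_assoc, eta_psi, <- tmap_comp, !act_eta, tmap_id).
- abstract (rewrite fmap_comp, <- comp_assoc, mu_psi, !comp_assoc;
            rewrite <- (comp_assoc _ (psi S X Y)), psi_nat, !comp_assoc;
            now rewrite <- !tmap_comp, !act_mu).
Defined.

Definition J_alg : Algebra T.
Proof.
refine {| carrier := J; act := psi0 S |}.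
- exact (eta_psi0 S).
- exact (mu_psi0 S).
Defined.

Definition star_alg_map (X X' Y Y' : Algebra T) (f : AlgHom X X') (g : AlgHom Y Y') :
  AlgHom (star_alg X Y) (star_alg X' Y').
Proof.
exists (und f ⊗[MS] und g).
abstract (simpl; rewrite <- comp_assoc, psi_nat, !comp_assoc, <- !tmap_comp;
          now rewrite !und_act).
Defined.

Lemma alghom_inv_act {A B : Algebra T} (f : Hom (carrier A) (carrier B))
  (g : Hom (carrier B) (carrier A)) :
  g ∘ f = idm _ -> f ∘ g = idm _ ->
  act B ∘ fmap T f = f ∘ act A -> act A ∘ fmap T g = g ∘ act B.
Proof.
intros gf fg Hf.
rewrite <- (comp_id_l (act A)), <- gf, <- (comp_assoc g), <- Hf.
now rewrite <- !comp_assoc, <- fmap_comp, fg, fmap_id, comp_id_r.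
Qed.

Lemma star_assoc_act (X Y Z : Algebra T) :
  act (star_alg X (star_alg Y Z)) ∘ fmap T (assoc MS X Y Z)
  = assoc MS X Y Z ∘ act (star_alg (star_alg X Y) Z).
Proof.
simpl.
rewrite (tmap_comp_r MS), (tmap_comp_l MS), !comp_assoc, assoc_nat.
rewrite <- !comp_assoc; f_equal.
rewrite !comp_assoc; symmetry; apply psi_assoc.
Qed.

Lemma star_lunit_act (X : Algebra T) :
  act X ∘ fmap T (lunit MS X) = lunit MS X ∘ act (star_alg J_alg X).
Proof.
simpl.
rewrite <- (psi_unit_l S), !comp_assoc, <- lunit_nat.
rewrite <- (comp_assoc _ (idm J ⊗[MS] act X)), <- tmap_comp.
now rewrite comp_id_l, comp_id_r.
Qed.

Lemma star_runit_act (X : Algebra T) :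
  act X ∘ fmap T (runit MS X) = runit MS X ∘ act (star_alg X J_alg).
Proof.
simpl.
rewrite <- (psi_unit_r S), !comp_assoc, <- runit_nat.
rewrite <- (comp_assoc _ (act X ⊗[MS] idm J)), <- tmap_comp.
now rewrite comp_id_l, comp_id_r.
Qed.

Definition star_EM : Monoidal (C := EM T) star_alg J_alg.
Proof.
refine (Build_Monoidal (EM T) star_alg J_alg
  star_alg_map _ _
  (fun X Y Z => Build_AlgHom _ T (star_alg (star_alg X Y) Z)
     (star_alg X (star_alg Y Z)) (assoc MS X Y Z) (star_assoc_act X Y Z))
  (fun X Y Z => Build_AlgHom _ T (star_alg X (star_alg Y Z))
     (star_alg (star_alg X Y) Z) (assoc_inv MS X Y Z)
     (alghom_inv_act (A := star_alg (star_alg X Y) Z)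
        (B := star_alg X (star_alg Y Z)) (assoc MS X Y Z) (assoc_inv MS X Y Z)
        (assocK MS X Y Z) (assoc_invK MS X Y Z) (star_assoc_act X Y Z)))
  _ _ _
  (fun X => Build_AlgHom _ T (star_alg J_alg X) X (lunit MS X) (star_lunit_act X))
  (fun X => Build_AlgHom _ T X (star_alg J_alg X) (lunit_inv MS X)
     (alghom_inv_act (A := star_alg J_alg X) (B := X) (lunit MS X)
        (lunit_inv MS X) (lunitK MS X) (lunit_invK MS X) (star_lunit_act X)))
  _ _ _
  (fun X => Build_AlgHom _ T (star_alg X J_alg) X (runit MS X) (star_runit_act X))
  (fun X => Build_AlgHom _ T X (star_alg X J_alg) (runit_inv MS X)
     (alghom_inv_act (A := star_alg X J_alg) (B := X) (runit MS X)
        (runit_inv MS X) (runitK MS X) (runit_invK MS X) (star_runit_act X)))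
  _ _ _ _ _);
abstract (intros; apply alghom_eq; simpl;
  first [ apply tmap_id | apply tmap_comp | apply assocK | apply assoc_invK
        | apply assoc_nat | apply lunitK | apply lunit_invK | apply lunit_nat
        | apply runitK | apply runit_invK | apply runit_nat
        | apply pentagon | apply triangle ]).
Defined.
End StarAlgebras.

Section IteratedTensor.
Context {C : Category} {dia : C -> C -> C} {I : C} (MD : Monoidal dia I).

(** [X1 ⋄ (X2 ⋄ (... ⋄ Xn))]: no trailing unit, so that the iterated tensor of
    [[X]] is [X] and that of [[X; Y]] is [dia X Y]. *)
Fixpoint tens {X : Type} (F : X -> C) (l : list X) : C :=
  match l with
  | [] => I
  | x :: l' => match l' with [] => F x | _ :: _ => dia (F x) (tens F l') end
  end.

Fixpoint tens_map {X : Type} {F G : X -> C} (h : forall x, Hom (F x) (G x))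
    (l : list X) : Hom (tens F l) (tens G l) :=
  match l return Hom (tens F l) (tens G l) with
  | [] => idm I
  | x :: l' =>
      match l' return Hom (tens F l') (tens G l') ->
                      Hom (tens F (x :: l')) (tens G (x :: l')) with
      | [] => fun _ => h x
      | _ :: _ => fun r => h x ⊗[MD] r
      end (tens_map h l')
  end.

Fixpoint phi_iter {T : Functor C C} (P : LaxMonoidal MD T) {X : Type} (F : X -> C)
    (l : list X) : Hom (tens (fun x => T (F x)) l) (T (tens F l)) :=
  match l return Hom (tens (fun x => T (F x)) l) (T (tens F l)) with
  | [] => phi0 P
  | x :: l' =>
      match l' return Hom (tens (fun y => T (F y)) l') (T (tens F l')) ->
                      Hom (tens (fun y => T (F y)) (x :: l')) (T (tens F (x :: l'))) with
      | [] => fun _ => idm (T (F x))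
      | y :: l'' => fun r => phi P (F x) (tens F (y :: l'')) ∘ (idm (T (F x)) ⊗[MD] r)
      end (phi_iter P F l')
  end.

(** The coherence isomorphism for concatenation; in a strict monoidal category
    it is an identity. *)
Fixpoint tens_split {X : Type} (F : X -> C) (l1 l2 : list X) :
    Hom (tens F (l1 ++ l2)) (dia (tens F l1) (tens F l2)) :=
  match l1 return Hom (tens F (l1 ++ l2)) (dia (tens F l1) (tens F l2)) with
  | [] => lunit_inv MD (tens F l2)
  | x :: l1' =>
      match l1' return Hom (tens F (l1' ++ l2)) (dia (tens F l1') (tens F l2)) ->
                       Hom (tens F (x :: l1' ++ l2)) (dia (tens F (x :: l1')) (tens F l2)) with
      | [] => fun _ =>
          match l2 return Hom (tens F (x :: l2)) (dia (F x) (tens F l2)) with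
          | [] => runit_inv MD (F x)
          | _ :: _ => idm _
          end
      | y :: l1'' => fun r =>
          assoc_inv MD (F x) (tens F (y :: l1'')) (tens F l2) ∘ (idm (F x) ⊗[MD] r)
      end (tens_split F l1' l2)
  end.
End IteratedTensor.
Arguments tens {C} dia I {X} F l.
Arguments tens_map {C dia I} MD {X F G} h l.
Arguments phi_iter {C dia I MD T} P {X} F l.
Arguments tens_split {C dia I} MD {X} F l1 l2.

Section Multilinear.
Context {C : Category} {dia : C -> C -> C} {I : C} {MD : Monoidal dia I}.
Context {T : Monad C} (P : MonoidalMonad MD T).

Definition multilinear (l : list (Algebra T)) (W : Algebra T)
    (f : Hom (tens dia I carrier l) (carrier W)) : Prop :=
  act W ∘ fmap T f ∘ phi_iter P carrier l = f ∘ tens_map MD act l.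

Definition universal (l : list (Algebra T)) (V : Algebra T)
    (u : Hom (tens dia I carrier l) (carrier V)) : Prop :=
  multilinear l V u /\
  forall (W : Algebra T) (f : Hom (tens dia I carrier l) (carrier W)),
    multilinear l W f -> exists! g : AlgHom V W, und g ∘ u = f.

Record UniversalMap (l : list (Algebra T)) := {
  um_cod : Algebra T;
  um_map :> Hom (tens dia I carrier l) (carrier um_cod);
  um_universal : universal l um_cod um_map
}.

(** A map in [C] out of the iterated tensor of a list of algebras, bundled with
    its domain and codomain. *)
Record MultiMap := {
  ml_dom : list (Algebra T);
  ml_cod : Algebra T;
  ml_map : Hom (tens dia I carrier ml_dom) (carrier ml_cod)
}.

(** [a1 ⋄ ... ⋄ an], precomposed with the coherence isomorphism out of the
    tensor of the concatenated domains. *)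
Fixpoint multi_tens (a : list MultiMap) :
    Hom (tens dia I carrier (flat_map ml_dom a)) (tens dia I carrier (map ml_cod a)) :=
  match a return Hom (tens dia I carrier (flat_map ml_dom a))
                     (tens dia I carrier (map ml_cod a)) with
  | [] => idm I
  | x :: a' =>
      match a' return Hom (tens dia I carrier (flat_map ml_dom a'))
                          (tens dia I carrier (map ml_cod a')) ->
                      Hom (tens dia I carrier (ml_dom x ++ flat_map ml_dom a'))
                          (tens dia I carrier (map ml_cod (x :: a'))) with
      | [] => fun _ =>
          ml_map x ∘ runit MD (tens dia I carrier (ml_dom x))
                   ∘ tens_split MD carrier (ml_dom x) []
      | y :: a'' => fun r =>
          (ml_map x ⊗[MD] r) ∘ tens_split MD carrier (ml_dom x) (flat_map ml_dom (y :: a''))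
      end (multi_tens a')
  end.

Definition universal_closed_under_composition : Prop :=
  forall (a : list MultiMap) (W : Algebra T)
         (b : Hom (tens dia I carrier (map ml_cod a)) (carrier W)),
    Forall (fun x => universal (ml_dom x) (ml_cod x) (ml_map x)) a ->
    universal (map ml_cod a) W b ->
    universal (flat_map ml_dom a) W (b ∘ multi_tens a).

Section Induced.
Variable u : forall l : list (Algebra T), UniversalMap l.

Definition dia_alg (A B : Algebra T) : Algebra T := um_cod _ (u [A; B]).

Definition bilin (A B : Algebra T) : Hom (dia A B) (carrier (dia_alg A B)) :=
  um_map _ (u [A; B]).

(** By universality these equations determine the tensor of algebra morphisms,
    the associator and the unitors. *)
Record is_induced (M : Monoidal (C := EM T) dia_alg (free_alg T I)) : Prop := {
  induced_tmap : forall (A A' B B' : EM T) (f : Hom A A') (g : Hom B B'),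
    und (f ⊗[M] g) ∘ bilin A B = bilin A' B' ∘ (und f ⊗[MD] und g);
  induced_assoc : forall A B D : Algebra T,
    und (assoc M A B D) ∘ bilin (dia_alg A B) D ∘ (bilin A B ⊗[MD] idm (carrier D))
    = bilin A (dia_alg B D) ∘ (idm (carrier A) ⊗[MD] bilin B D) ∘ assoc MD A B D;
  induced_lunit : forall A : Algebra T,
    und (lunit M A) ∘ bilin (free_alg T I) A ∘ (phi0 P ⊗[MD] idm (carrier A))
    = lunit MD A;
  induced_runit : forall A : Algebra T,
    und (runit M A) ∘ bilin A (free_alg T I) ∘ (idm (carrier A) ⊗[MD] phi0 P)
    = runit MD A
}.
End Induced.
End Multilinear.
Arguments UniversalMap {C dia I MD T} P l.
Arguments um_cod {C dia I MD T P l} _.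
Arguments um_map {C dia I MD T P l} _.
Arguments um_universal {C dia I MD T P l} _.
Arguments dia_alg {C dia I MD T P} u A B.
Arguments bilin {C dia I MD T P} u A B.
Arguments is_induced {C dia I MD T P} u M.

(* Main.v *)
(** Algebra morphisms that agree after precomposition with a universal multilinear
    map are equal, so every algebra map out of an iterated tensor product is
    defined, and every equation between such maps is checked, after restriction
    along universal maps down to [C], where it becomes the corresponding equation
    of [MD] or of [D].  Closure under composition supplies these universal maps for
    nested tensor products; the unit enters as the empty bracket through [phi0],
    and the unary universal maps as the identities. *)

Require Import Defs.
From Stdlib Require Import List ClassicalEpsilon.
Import ListNotations.

(** * Rewriting modulo associativity of composition *)

Section Reassociation.
Context {C : Category}.

(** Composites are kept bracketed to the right, so a factor [g ∘ f] occurs only with a tail [h]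
    behind it; this form lets the equation be rewritten there. *)
Lemma comp_tail2 {X Y Z W : C} {g : Hom Y Z} {f : Hom X Y} {k : Hom X Z}
  (E : g ∘ f = k) (h : Hom W X) : g ∘ (f ∘ h) = k ∘ h.
Proof. now rewrite comp_assoc, E. Qed.

Lemma comp_tail3 {X Y Y' Z W : C} {a : Hom Y' Z} {g : Hom Y Y'} {f : Hom X Y}
  {k : Hom X Z} (E : a ∘ g ∘ f = k) (h : Hom W X) : a ∘ (g ∘ (f ∘ h)) = k ∘ h.
Proof. now rewrite !comp_assoc, E. Qed.

Lemma comp_rassoc3 {X Y Y' Z : C} {a : Hom Y' Z} {g : Hom Y Y'} {f : Hom X Y}
  {k : Hom X Z} (E : a ∘ g ∘ f = k) : a ∘ (g ∘ f) = k.
Proof. now rewrite comp_assoc. Qed.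

Lemma tmap_fuse {ten : C -> C -> C} {e : C} (M : Monoidal ten e)
  {X X' X'' Y Y' Y'' Z : C} (f' : Hom X' X'') (g' : Hom Y' Y'')
  (f : Hom X X') (g : Hom Y Y') (h : Hom Z (ten X Y)) :
  (f' ⊗[M] g') ∘ ((f ⊗[M] g) ∘ h) = ((f' ∘ f) ⊗[M] (g' ∘ g)) ∘ h.
Proof. now rewrite comp_assoc, tmap_comp. Qed.
End Reassociation.

(* [simpl in H] reduces the carriers of free and product algebras, so that [H]
   matches goals that are in the same normal form. *)
Ltac crewrite2 E := let H := fresh in pose proof E as H; simpl in H;
  rewrite <- ?comp_assoc; first [rewrite H | rewrite (comp_tail2 H)];
  rewrite <- ?comp_assoc; clear H.
Ltac crewrite3 E := let H := fresh in pose proof E as H; simpl in H;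
  rewrite <- ?comp_assoc;
  first [rewrite (comp_rassoc3 H) | rewrite (comp_tail3 H)];
  rewrite <- ?comp_assoc; clear H.
Ltac fuse := rewrite <- ?comp_assoc;
  repeat (first [rewrite tmap_fuse | rewrite <- tmap_comp]; rewrite <- ?comp_assoc).
Ltac cids := rewrite ?tmap_id, ?comp_id_l, ?comp_id_r.

(** * Unit coherence in a monoidal category *)

Section Coherence.
Context {C : Category} {ten : C -> C -> C} {e : C} (M : Monoidal ten e).
Local Notation "f ⊗ g" := (tmap M f g) (at level 39, no associativity).

(** The right unitor is natural and invertible, so it conjugates [f ⊗ idm e] back to [f]. *)
Lemma tmap_unit_r_inj {X Y : C} (f g : Hom X Y) : f ⊗ idm e = g ⊗ idm e -> f = g.
Proof.
intros E.
rewrite <- (comp_id_r f), <- (comp_id_r g), <- (runit_invK M X), !comp_assoc.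
now rewrite <- !runit_nat, E.
Qed.

Lemma tmap_unit_l_inj {X Y : C} (f g : Hom X Y) : idm e ⊗ f = idm e ⊗ g -> f = g.
Proof.
intros E.
rewrite <- (comp_id_r f), <- (comp_id_r g), <- (lunit_invK M X), !comp_assoc.
now rewrite <- !lunit_nat, E.
Qed.

(* Kelly: [pentagon] and [triangle] imply the remaining unit coherences. *)
Lemma runit_tensor (X Y : C) :
  runit M (ten X Y) = (idm X ⊗ runit M Y) ∘ assoc M X Y e.
Proof.
apply tmap_unit_r_inj.
(* Inserting [assoc_inv ∘ assoc] on the left reduces the goal to an equality after the associator,
   where [triangle] trades right unitors for [lunit M e] and [pentagon] compares the associators. *)
rewrite <- (comp_id_l (runit M (ten X Y) ⊗ idm e)), <- (assocK M X Y e).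
rewrite <- (comp_id_l (((idm X ⊗ runit M Y) ∘ assoc M X Y e) ⊗ idm e)),
  <- (assocK M X Y e).
rewrite <- !comp_assoc; f_equal.
rewrite <- triangle, (tmap_comp_l M).
crewrite2 (assoc_nat M (idm X) (runit M Y) (idm e)).
rewrite <- triangle, (tmap_comp_r M), <- !comp_assoc, pentagon.
rewrite !comp_assoc, <- assoc_nat. now rewrite tmap_id.
Qed.

Lemma lunit_runit_unit : lunit M e = runit M e.
Proof.
apply tmap_unit_l_inj.
rewrite <- (comp_id_r (idm e ⊗ lunit M e)), <- (comp_id_r (idm e ⊗ runit M e)).
rewrite <- (assoc_invK M e e e), !comp_assoc; f_equal.
(* What remains is [runit M e ⊗ idm e = runit M (ten e e)]. Both sides agree after the invertible
   [runit M e], by naturality of the right unitor at itself. *)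
rewrite triangle, <- runit_tensor.
rewrite <- (comp_id_l (runit M e ⊗ idm e)), <- (comp_id_l (runit M (ten e e))).
rewrite <- (runitK M e), <- !comp_assoc; f_equal.
apply runit_nat.
Qed.
End Coherence.

(** * Universal multilinear maps and the extensions they define *)

Section UniversalMultilinear.
Context {C : Category} {dia : C -> C -> C} {I : C} {MD : Monoidal dia I}.
Context {T : Monad C} (P : MonoidalMonad MD T).

Lemma universal_extension {l : list (Algebra T)} {V : Algebra T} {m}
  (U : universal P l V m) {W : Algebra T} {f} (Hf : multilinear P l W f) :
  exists g : AlgHom V W, und g ∘ m = f.
Proof. destruct (proj2 U W f Hf) as [g [Hg _]]. now exists g. Qed.

(** The universal property is a [Prop], while the structure maps of a monoidal category are data;
    the description axiom selects the extension. *)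
Definition uext {l : list (Algebra T)} {V : Algebra T} {m}
  (U : universal P l V m) {W : Algebra T} {f} (Hf : multilinear P l W f) : AlgHom V W :=
  proj1_sig (constructive_indefinite_description _ (universal_extension U Hf)).

Lemma uext_comp {l : list (Algebra T)} {V : Algebra T} {m}
  (U : universal P l V m) {W : Algebra T} {f} (Hf : multilinear P l W f) :
  und (uext U Hf) ∘ m = f.
Proof.
exact (proj2_sig (constructive_indefinite_description _ (universal_extension U Hf))).
Qed.

(** Cancellation is asked only against morphisms of algebras, so [m] may start from any object of
    [C] and need not be an epimorphism there. *)
Definition alg_epi {X : C} (V : Algebra T) (m : Hom X (carrier V)) : Prop :=
  forall (W : Algebra T) (g h : AlgHom V W), und g ∘ m = und h ∘ m -> g = h.

Lemma alg_epi_comp {X Y : C} {V : Algebra T} {m : Hom X (carrier V)} {k : Hom Y X} :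
  alg_epi V (m ∘ k) -> alg_epi V m.
Proof. intros E W g h H; apply E; now rewrite !comp_assoc, H. Qed.

Lemma multilinear_alghom {l : list (Algebra T)} {V W : Algebra T} {m}
  (g : AlgHom V W) : multilinear P l V m -> multilinear P l W (und g ∘ m).
Proof.
unfold multilinear; intros H.
rewrite fmap_comp, comp_assoc, und_act, <- !comp_assoc; f_equal.
now rewrite comp_assoc.
Qed.

Lemma universal_epi {l : list (Algebra T)} {V : Algebra T} {m} :
  universal P l V m -> alg_epi V m.
Proof.
intros [Hm U] W g h E.
destruct (U W _ (multilinear_alghom g Hm)) as [k [_ Hk]].
now rewrite <- (Hk g eq_refl), <- (Hk h (eq_sym E)).
Qed.

(** On two factors [phi_iter] carries a tensor of two identities, the second coming from its value
    on a singleton; only this has to be removed. *)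
Lemma bilinearE (X Y W : Algebra T) (f : Hom (dia X Y) W) :
  act W ∘ fmap T f ∘ phi P X Y = f ∘ (act X ⊗[MD] act Y) <-> multilinear P [X; Y] W f.
Proof. unfold multilinear; simpl. now rewrite tmap_id, comp_id_r. Qed.

(** Unary multilinear maps out of [X] are exactly the algebra morphisms out of [X]. *)
Lemma universal_id (X : Algebra T) : universal P [X] X (idm (carrier X)).
Proof.
split.
- unfold multilinear; simpl. now rewrite fmap_id, !comp_id_r, comp_id_l.
- unfold multilinear; simpl; intros W f Hf. rewrite comp_id_r in Hf.
  exists (Build_AlgHom _ _ X W f Hf); split; simpl.
  + apply comp_id_r.
  + intros g Hg; apply alghom_eq; simpl. now rewrite <- Hg, comp_id_r.
Qed.

Lemma phi0_multilinear : multilinear P [] (free_alg T I) (phi0 P).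
Proof.
unfold multilinear; simpl.
now rewrite comp_id_r, <- comp_assoc, <- mu_phi0.
Qed.

(** By [eta_phi0] the map [phi0] is the monad unit at [I], so this is the universal property of the
    free algebra: [f] extends to [act W ∘ fmap T f]. *)
Lemma universal_phi0 : universal P [] (free_alg T I) (phi0 P).
Proof.
split; [exact phi0_multilinear|].
intros W f _; simpl in f.
assert (Hf : act W ∘ fmap T (act W ∘ fmap T f) = act W ∘ fmap T f ∘ mu T I).
{ rewrite fmap_comp, comp_assoc, <- act_mu, <- !comp_assoc; f_equal; apply mu_nat. }
exists (Build_AlgHom _ _ (free_alg T I) W (act W ∘ fmap T f) Hf); split; simpl.
- rewrite eta_phi0, <- comp_assoc, <- eta_nat, comp_assoc, act_eta. apply comp_id_l.
- intros g Hg; apply alghom_eq; simpl.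
  pose proof (und_act g) as E; simpl in E.
  rewrite <- Hg, fmap_comp, comp_assoc, E, <- comp_assoc, eta_phi0.
  rewrite mu_eta_r. apply comp_id_r.
Qed.

(** * Universal maps for nested tensor products *)

Section ClosedUniversals.
Context (u : forall l : list (Algebra T), UniversalMap P l)
        (u_comp : universal_closed_under_composition P).

Local Notation "X ⋄ Y" := (dia_alg u X Y) (at level 39, no associativity).
Local Notation "f ⊗ g" := (tmap MD f g) (at level 39, no associativity).
Local Notation b := (bilin u).
Local Notation TI := (free_alg T I).

Lemma universal_bilin (X Y : Algebra T) : universal P [X; Y] (X ⋄ Y) (b X Y).
Proof. exact (um_universal (u [X; Y])). Qed.

Lemma bilin_bilinear (X Y : Algebra T) :
  act (X ⋄ Y) ∘ fmap T (b X Y) ∘ phi P X Y = b X Y ∘ (act X ⊗ act Y).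
Proof. apply bilinearE, universal_bilin. Qed.

Lemma bilin_tmap_bilinear {X X' Y Y' : Algebra T} (f : AlgHom X X') (g : AlgHom Y Y') :
  multilinear P [X; Y] (X' ⋄ Y') (b X' Y' ∘ (und f ⊗ und g)).
Proof.
apply bilinearE.
rewrite fmap_comp. crewrite2 (eq_sym (phi_nat P (und f) (und g))).
crewrite3 (bilin_bilinear X' Y'). fuse. now rewrite !und_act.
Qed.

(** Closure under composition for two inner maps and the outer map [b V1 V2]. The unitor, the
    splittings and [++ []] are what [multi_tens] produces on a list of length two. *)
Lemma universal_bilin_comp {l1 l2 : list (Algebra T)} {V1 V2 : Algebra T} {m1 m2}
  (U1 : universal P l1 V1 m1) (U2 : universal P l2 V2 m2) :
  universal P (l1 ++ l2 ++ []) (V1 ⋄ V2)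
    (b V1 V2 ∘ ((m1 ⊗ (m2 ∘ runit MD (tens dia I carrier l2) ∘ tens_split MD carrier l2 []))
      ∘ tens_split MD carrier l1 (l2 ++ []))).
Proof.
apply (u_comp [Build_MultiMap l1 V1 m1; Build_MultiMap l2 V2 m2] (V1 ⋄ V2) (b V1 V2)).
- constructor; [exact U1|constructor; [exact U2|constructor]].
- apply universal_bilin.
Qed.

Lemma bilin_tmap_epi {l1 l2 : list (Algebra T)} {V1 V2 : Algebra T} {m1 m2}
  (U1 : universal P l1 V1 m1) (U2 : universal P l2 V2 m2) :
  alg_epi (V1 ⋄ V2) (b V1 V2 ∘ (m1 ⊗ m2)).
Proof.
pose proof (universal_epi (universal_bilin_comp U1 U2)) as H.
rewrite <- (comp_assoc m2), (tmap_comp_r MD), <- !comp_assoc, comp_assoc in H.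
exact (alg_epi_comp H).
Qed.

Lemma bilin_id_epi {l : list (Algebra T)} {V X : Algebra T} {m}
  (U : universal P l V m) : alg_epi (V ⋄ X) (b V X ∘ (m ⊗ idm (carrier X))).
Proof. exact (bilin_tmap_epi U (universal_id X)). Qed.

Lemma universal_bilin_left {l : list (Algebra T)} {V : Algebra T} {m} (X : Algebra T) :
  universal P l V m ->
  universal P (l ++ [X]) (V ⋄ X)
    (b V X ∘ (m ⊗ idm (carrier X)) ∘ tens_split MD carrier l [X]).
Proof.
intros U.
pose proof (universal_bilin_comp U (universal_id X)) as H.
simpl in H. now rewrite comp_id_l, runit_invK, comp_assoc in H.
Qed.

(** Both bracketings are universal for the same list [[X; Y; Z]]; comparing them gives the
    associator and its inverse. *)
Lemma universal_triple_l (X Y Z : Algebra T) :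
  universal P [X; Y; Z] ((X ⋄ Y) ⋄ Z)
    (b (X ⋄ Y) Z ∘ (b X Y ⊗ idm (carrier Z)) ∘ assoc_inv MD X Y Z).
Proof.
pose proof (universal_bilin_left Z (universal_bilin X Y)) as H.
simpl in H. now rewrite tmap_id, comp_id_r in H.
Qed.

Lemma universal_triple_r (X Y Z : Algebra T) :
  universal P [X; Y; Z] (X ⋄ (Y ⋄ Z)) (b X (Y ⋄ Z) ∘ (idm (carrier X) ⊗ b Y Z)).
Proof.
pose proof (universal_bilin_comp (universal_id X) (universal_bilin Y Z)) as H.
simpl in H.
(* Splitting the unitor of the product lets it cancel against [tens_split] of [[Y; Z]] with the
   empty list, factor by factor. *)
rewrite runit_tensor, <- !comp_assoc in H.
rewrite (comp_tail2 (assoc_invK MD _ _ _)), comp_id_l in H.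
now rewrite <- tmap_comp, comp_id_l, runit_invK, tmap_id, !comp_id_r in H.
Qed.

Lemma universal_unit_l (X : Algebra T) :
  universal P [X] (TI ⋄ X) (b TI X ∘ (phi0 P ⊗ idm (carrier X)) ∘ lunit_inv MD X).
Proof. exact (universal_bilin_left X universal_phi0). Qed.

Lemma universal_unit_r (X : Algebra T) :
  universal P [X] (X ⋄ TI) (b X TI ∘ (idm (carrier X) ⊗ phi0 P) ∘ runit_inv MD X).
Proof.
pose proof (universal_bilin_comp (universal_id X) universal_phi0) as H.
simpl in H.
(* For the empty list [multi_tens] uses the right unitor at [I] but [tens_split] the inverse of the
   left one; they cancel because the two unitors agree at the unit. *)
now rewrite <- (comp_assoc (phi0 P)), <- lunit_runit_unit, lunit_invK, comp_id_r,
  comp_assoc in H.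
Qed.

(** * Cancellation along nested tensor products *)

Lemma bilin_epi (X Y : Algebra T) : alg_epi (X ⋄ Y) (b X Y).
Proof. exact (universal_epi (universal_bilin X Y)). Qed.

Lemma triple_l_epi (X Y Z : Algebra T) :
  alg_epi ((X ⋄ Y) ⋄ Z) (b (X ⋄ Y) Z ∘ (b X Y ⊗ idm (carrier Z))).
Proof. exact (bilin_id_epi (universal_bilin X Y)). Qed.

Lemma triple_r_epi (X Y Z : Algebra T) :
  alg_epi (X ⋄ (Y ⋄ Z)) (b X (Y ⋄ Z) ∘ (idm (carrier X) ⊗ b Y Z)).
Proof. exact (universal_epi (universal_triple_r X Y Z)). Qed.

Lemma unit_l_epi (X : Algebra T) :
  alg_epi (TI ⋄ X) (b TI X ∘ (phi0 P ⊗ idm (carrier X))).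
Proof. exact (bilin_id_epi universal_phi0). Qed.

Lemma unit_r_epi (X : Algebra T) :
  alg_epi (X ⋄ TI) (b X TI ∘ (idm (carrier X) ⊗ phi0 P)).
Proof. exact (bilin_tmap_epi (universal_id X) universal_phi0). Qed.

(** This cancels on the domain of the pentagon. The inverse associator inside the ternary universal
    map stands on the right and is dropped. *)
Lemma quadruple_epi (W X Y Z : Algebra T) :
  alg_epi (((W ⋄ X) ⋄ Y) ⋄ Z)
    (b ((W ⋄ X) ⋄ Y) Z ∘ ((b (W ⋄ X) Y ∘ (b W X ⊗ idm (carrier Y))) ⊗ idm (carrier Z))).
Proof.
pose proof (bilin_id_epi (X := Z) (universal_triple_l W X Y)) as H.
rewrite (tmap_comp_l MD), comp_assoc in H.
exact (alg_epi_comp H).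
Qed.

Lemma triangle_epi (X Y : Algebra T) :
  alg_epi ((X ⋄ TI) ⋄ Y)
    (b (X ⋄ TI) Y ∘ ((b X TI ∘ (idm (carrier X) ⊗ phi0 P)) ⊗ idm (carrier Y))).
Proof.
pose proof (bilin_id_epi (X := Y) (universal_unit_r X)) as H.
rewrite (tmap_comp_l MD), comp_assoc in H.
exact (alg_epi_comp H).
Qed.

(** * Tensor, associator and unitors on algebras *)

Definition dia_map {X X' Y Y' : Algebra T} (f : AlgHom X X') (g : AlgHom Y Y') :
  AlgHom (X ⋄ Y) (X' ⋄ Y') :=
  uext (universal_bilin X Y) (bilin_tmap_bilinear f g).

Definition dia_assoc (X Y Z : Algebra T) : AlgHom ((X ⋄ Y) ⋄ Z) (X ⋄ (Y ⋄ Z)) :=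
  uext (universal_triple_l X Y Z) (proj1 (universal_triple_r X Y Z)).

Definition dia_assoc_inv (X Y Z : Algebra T) : AlgHom (X ⋄ (Y ⋄ Z)) ((X ⋄ Y) ⋄ Z) :=
  uext (universal_triple_r X Y Z) (proj1 (universal_triple_l X Y Z)).

(** [X] with its identity is also universal for [[X]], so each unitor compares two universal maps
    for one list. *)
Definition dia_lunit (X : Algebra T) : AlgHom (TI ⋄ X) X :=
  uext (universal_unit_l X) (proj1 (universal_id X)).

Definition dia_lunit_inv (X : Algebra T) : AlgHom X (TI ⋄ X) :=
  uext (universal_id X) (proj1 (universal_unit_l X)).

Definition dia_runit (X : Algebra T) : AlgHom (X ⋄ TI) X :=
  uext (universal_unit_r X) (proj1 (universal_id X)).

Definition dia_runit_inv (X : Algebra T) : AlgHom X (X ⋄ TI) :=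
  uext (universal_id X) (proj1 (universal_unit_r X)).

Lemma dia_map_bilin {X X' Y Y' : Algebra T} (f : AlgHom X X') (g : AlgHom Y Y') :
  und (dia_map f g) ∘ b X Y = b X' Y' ∘ (und f ⊗ und g).
Proof. exact (uext_comp (universal_bilin X Y) (bilin_tmap_bilinear f g)). Qed.

Lemma dia_assoc_bilin (X Y Z : Algebra T) :
  und (dia_assoc X Y Z) ∘ b (X ⋄ Y) Z ∘ (b X Y ⊗ idm (carrier Z))
  = b X (Y ⋄ Z) ∘ (idm (carrier X) ⊗ b Y Z) ∘ assoc MD X Y Z.
Proof.
pose proof (uext_comp (universal_triple_l X Y Z) (proj1 (universal_triple_r X Y Z))) as H.
fold (dia_assoc X Y Z) in H; simpl in H.
rewrite <- H, <- !comp_assoc, assocK. now rewrite comp_id_r.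
Qed.

Lemma dia_assoc_inv_bilin (X Y Z : Algebra T) :
  und (dia_assoc_inv X Y Z) ∘ b X (Y ⋄ Z) ∘ (idm (carrier X) ⊗ b Y Z)
  = b (X ⋄ Y) Z ∘ (b X Y ⊗ idm (carrier Z)) ∘ assoc_inv MD X Y Z.
Proof.
rewrite <- comp_assoc.
exact (uext_comp (universal_triple_r X Y Z) (proj1 (universal_triple_l X Y Z))).
Qed.

Lemma dia_lunit_bilin (X : Algebra T) :
  und (dia_lunit X) ∘ b TI X ∘ (phi0 P ⊗ idm (carrier X)) = lunit MD X.
Proof.
pose proof (uext_comp (universal_unit_l X) (proj1 (universal_id X))) as H.
fold (dia_lunit X) in H; simpl in H.
apply (f_equal (fun k => k ∘ lunit MD X)) in H.
now rewrite <- ?comp_assoc, lunitK, comp_id_r, comp_id_l, comp_assoc in H.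
Qed.

Lemma dia_lunit_invE (X : Algebra T) :
  und (dia_lunit_inv X) = b TI X ∘ (phi0 P ⊗ idm (carrier X)) ∘ lunit_inv MD X.
Proof.
rewrite <- (comp_id_r (und _)).
exact (uext_comp (universal_id X) (proj1 (universal_unit_l X))).
Qed.

Lemma dia_runit_bilin (X : Algebra T) :
  und (dia_runit X) ∘ b X TI ∘ (idm (carrier X) ⊗ phi0 P) = runit MD X.
Proof.
pose proof (uext_comp (universal_unit_r X) (proj1 (universal_id X))) as H.
fold (dia_runit X) in H; simpl in H.
apply (f_equal (fun k => k ∘ runit MD X)) in H.
now rewrite <- ?comp_assoc, runitK, comp_id_r, comp_id_l, comp_assoc in H.
Qed.

Lemma dia_runit_invE (X : Algebra T) :
  und (dia_runit_inv X) = b X TI ∘ (idm (carrier X) ⊗ phi0 P) ∘ runit_inv MD X.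
Proof.
rewrite <- (comp_id_r (und _)).
exact (uext_comp (universal_id X) (proj1 (universal_unit_r X))).
Qed.

(** * Naturality, invertibility and coherence of these maps *)

Lemma dia_assoc_natural {X X' Y Y' Z Z' : Algebra T}
  (f : AlgHom X X') (g : AlgHom Y Y') (h : AlgHom Z Z') :
  alg_comp _ _ _ (dia_assoc X' Y' Z') (dia_map (dia_map f g) h)
  = alg_comp _ _ _ (dia_map f (dia_map g h)) (dia_assoc X Y Z).
Proof.
apply triple_l_epi; simpl.
crewrite2 (dia_map_bilin (dia_map f g) h). fuse.
rewrite dia_map_bilin. cids.
crewrite3 (dia_assoc_bilin X Y Z).
crewrite2 (dia_map_bilin f (dia_map g h)). fuse. rewrite dia_map_bilin. cids.
(* Factoring [und h] through an identity exposes [b X' Y' ⊗ idm], the shape on which the associator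
   is determined. *)
rewrite <- (comp_id_l (und h)), tmap_comp.
crewrite3 (dia_assoc_bilin X' Y' Z').
crewrite2 (assoc_nat MD (und f) (und g) (und h)).
fuse. now cids.
Qed.

Lemma dia_assocK (X Y Z : Algebra T) :
  alg_comp _ _ _ (dia_assoc_inv X Y Z) (dia_assoc X Y Z) = alg_id _.
Proof.
apply triple_l_epi; simpl.
crewrite3 (dia_assoc_bilin X Y Z). crewrite3 (dia_assoc_inv_bilin X Y Z).
rewrite <- ?comp_assoc, assocK. now cids.
Qed.

Lemma dia_assoc_invK (X Y Z : Algebra T) :
  alg_comp _ _ _ (dia_assoc X Y Z) (dia_assoc_inv X Y Z) = alg_id _.
Proof.
apply triple_r_epi; simpl.
crewrite3 (dia_assoc_inv_bilin X Y Z). crewrite3 (dia_assoc_bilin X Y Z).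
rewrite <- ?comp_assoc, assoc_invK. now cids.
Qed.

Lemma dia_lunitK (X : Algebra T) :
  alg_comp _ _ _ (dia_lunit_inv X) (dia_lunit X) = alg_id _.
Proof.
apply unit_l_epi; simpl.
crewrite3 (dia_lunit_bilin X). rewrite dia_lunit_invE, <- ?comp_assoc, lunitK. now cids.
Qed.

Lemma dia_lunit_invK (X : Algebra T) :
  alg_comp _ _ _ (dia_lunit X) (dia_lunit_inv X) = alg_id _.
Proof.
apply alghom_eq; simpl.
rewrite dia_lunit_invE. crewrite3 (dia_lunit_bilin X). apply lunit_invK.
Qed.

Lemma dia_runitK (X : Algebra T) :
  alg_comp _ _ _ (dia_runit_inv X) (dia_runit X) = alg_id _.
Proof.
apply unit_r_epi; simpl.
crewrite3 (dia_runit_bilin X). rewrite dia_runit_invE, <- ?comp_assoc, runitK. now cids.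
Qed.

Lemma dia_runit_invK (X : Algebra T) :
  alg_comp _ _ _ (dia_runit X) (dia_runit_inv X) = alg_id _.
Proof.
apply alghom_eq; simpl.
rewrite dia_runit_invE. crewrite3 (dia_runit_bilin X). apply runit_invK.
Qed.

Lemma dia_lunit_natural {X X' : Algebra T} (f : AlgHom X X') :
  alg_comp _ _ _ (dia_lunit X') (dia_map (alg_id TI) f) = alg_comp _ _ _ f (dia_lunit X).
Proof.
apply unit_l_epi; simpl.
crewrite2 (dia_map_bilin (alg_id TI) f). crewrite3 (dia_lunit_bilin X). fuse. simpl. cids.
rewrite <- lunit_nat, <- (dia_lunit_bilin X'). fuse. now cids.
Qed.

Lemma dia_runit_natural {X X' : Algebra T} (f : AlgHom X X') :
  alg_comp _ _ _ (dia_runit X') (dia_map f (alg_id TI)) = alg_comp _ _ _ f (dia_runit X).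
Proof.
apply unit_r_epi; simpl.
crewrite2 (dia_map_bilin f (alg_id TI)). crewrite3 (dia_runit_bilin X). fuse. simpl. cids.
rewrite <- runit_nat, <- (dia_runit_bilin X'). fuse. now cids.
Qed.

Lemma dia_pentagon (W X Y Z : Algebra T) :
  alg_comp _ _ _ (dia_map (alg_id W) (dia_assoc X Y Z))
    (alg_comp _ _ _ (dia_assoc W (X ⋄ Y) Z) (dia_map (dia_assoc W X Y) (alg_id Z)))
  = alg_comp _ _ _ (dia_assoc W X (Y ⋄ Z)) (dia_assoc (W ⋄ X) Y Z).
Proof.
apply quadruple_epi; simpl.
crewrite2 (dia_map_bilin (dia_assoc W X Y) (alg_id Z)). fuse. simpl. cids.
crewrite3 (dia_assoc_bilin W X Y).
rewrite <- ?comp_assoc, (tmap_comp_l MD), (tmap_comp_l MD).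
crewrite3 (dia_assoc_bilin W (X ⋄ Y) Z).
crewrite2 (assoc_nat MD (idm W) (b X Y) (idm Z)).
crewrite2 (dia_map_bilin (alg_id W) (dia_assoc X Y Z)). fuse. simpl. cids.
crewrite3 (dia_assoc_bilin X Y Z).
(* The left side is now nested [b] maps after three associators of [MD], so the pentagon in [C]
   applies; the rest brings the right side to the same form. *)
rewrite !(tmap_comp_r MD), <- ?comp_assoc, pentagon.
rewrite (tmap_comp_l MD).
crewrite3 (dia_assoc_bilin (W ⋄ X) Y Z).
crewrite2 (assoc_nat MD (b W X) (idm Y) (idm Z)). fuse. cids.
(* The interchange [b W X ⊗ b Y Z = (b W X ⊗ idm) ∘ (idm ⊗ b Y Z)] exposes the map determining the
   next associator. *)
rewrite <- (comp_id_r (b W X)), <- (comp_id_l (b Y Z)), tmap_comp.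
crewrite3 (dia_assoc_bilin W X (Y ⋄ Z)).
rewrite <- (tmap_id MD W X).
crewrite2 (assoc_nat MD (idm W) (idm X) (b Y Z)). fuse. now cids.
Qed.

Lemma dia_triangle (X Y : Algebra T) :
  alg_comp _ _ _ (dia_map (alg_id X) (dia_lunit Y)) (dia_assoc X TI Y)
  = dia_map (dia_runit X) (alg_id Y).
Proof.
apply triangle_epi; simpl.
crewrite2 (dia_map_bilin (dia_runit X) (alg_id Y)). fuse. simpl. cids.
crewrite3 (dia_runit_bilin X).
rewrite (tmap_comp_l MD).
crewrite3 (dia_assoc_bilin X TI Y).
rewrite assoc_nat.
crewrite2 (dia_map_bilin (alg_id X) (dia_lunit Y)). fuse. simpl. cids.
crewrite3 (dia_lunit_bilin Y).
now rewrite triangle.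
Qed.
Lemma dia_map_id (X Y : Algebra T) : dia_map (alg_id X) (alg_id Y) = alg_id (X ⋄ Y).
Proof. apply bilin_epi; simpl. rewrite dia_map_bilin; simpl. now cids. Qed.

Lemma dia_map_comp {X X' X'' Y Y' Y'' : Algebra T}
  (f' : AlgHom X' X'') (f : AlgHom X X') (g' : AlgHom Y' Y'') (g : AlgHom Y Y') :
  dia_map (alg_comp _ _ _ f' f) (alg_comp _ _ _ g' g)
  = alg_comp _ _ _ (dia_map f' g') (dia_map f g).
Proof.
apply bilin_epi; simpl.
rewrite dia_map_bilin; simpl.
crewrite2 (dia_map_bilin f g). crewrite2 (dia_map_bilin f' g'). now fuse.
Qed.

Definition dia_EM : Monoidal (C := EM T) (dia_alg u) TI :=
  Build_Monoidal (EM T) (dia_alg u) TI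
    (fun X X' Y Y' f g => dia_map f g) dia_map_id
    (fun X X' X'' Y Y' Y'' f' f g' g => dia_map_comp f' f g' g)
    dia_assoc dia_assoc_inv dia_assocK dia_assoc_invK
    (fun X X' Y Y' Z Z' f g h => dia_assoc_natural f g h)
    dia_lunit dia_lunit_inv dia_lunitK dia_lunit_invK
    (fun X X' f => dia_lunit_natural f)
    dia_runit dia_runit_inv dia_runitK dia_runit_invK
    (fun X X' f => dia_runit_natural f)
    dia_pentagon dia_triangle.

Lemma dia_EM_induced : is_induced u dia_EM.
Proof.
constructor.
- intros; apply dia_map_bilin.
- exact dia_assoc_bilin.
- exact dia_lunit_bilin.
- exact dia_runit_bilin.
Qed.
End ClosedUniversals.
End UniversalMultilinear.

(** * Interchange law and unit maps on algebras *)

Section DuoidalAlgebras.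
Context {C : Category} {dia : C -> C -> C} {I : C} {MD : Monoidal dia I}.
Context {star : C -> C -> C} {J : C} {MS : Monoidal star J}.
Context (D : Duoidal MD MS) {T : Monad C} (B : BimonoidalMonad D T).
Context (u : forall l : list (Algebra T), UniversalMap (bm_phi B) l)
        (u_comp : universal_closed_under_composition (bm_phi B)).

Local Notation P := (bm_phi B).
Local Notation S := (bm_psi B).
Local Notation TI := (free_alg T I).
Local Notation JT := (J_alg S).
Local Notation b := (bilin u).
Local Notation "X ⋄ Y" := (dia_alg u X Y) (at level 39, no associativity).
Local Notation "X ⋆ Y" := (star_alg S X Y) (at level 39, no associativity).
Local Notation "f [⋄] g" := (tmap MD f g) (at level 39, no associativity).
Local Notation "f [⋆] g" := (tmap MS f g) (at level 39, no associativity).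
Local Notation "f ⋄⋄ g" := (dia_map P u f g) (at level 39, no associativity).
Local Notation "f ⋆⋆ g" := (star_alg_map S _ _ _ _ f g) (at level 39, no associativity).
Local Notation α := (dia_assoc P u u_comp).

(** The axiom [bm_zeta] carries the action past [zeta]; bilinearity of [b] in each [star] factor and
    naturality of [zeta] do the rest. *)
Lemma zeta_bilinear (X Y X' Y' : Algebra T) :
  multilinear P [X ⋆ Y; X' ⋆ Y'] ((X ⋄ X') ⋆ (Y ⋄ Y'))
    ((b X X' [⋆] b Y Y') ∘ zeta D X Y X' Y').
Proof.
apply bilinearE; simpl.
rewrite fmap_comp.
crewrite2 (psi_nat S (b X X') (b Y Y')).
pose proof (bm_zeta B X Y X' Y') as H.
rewrite <- !comp_assoc in H; rewrite <- H; clear H.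
fuse.
crewrite3 (bilin_bilinear P u X X'). crewrite3 (bilin_bilinear P u Y Y').
rewrite (tmap_comp MD).
crewrite2 (zeta_nat D (act X) (act Y) (act X') (act Y')).
now fuse.
Qed.

Definition zeta_alg (X Y X' Y' : Algebra T) :
  AlgHom ((X ⋆ Y) ⋄ (X' ⋆ Y')) ((X ⋄ X') ⋆ (Y ⋄ Y')) :=
  uext P (universal_bilin P u (X ⋆ Y) (X' ⋆ Y')) (zeta_bilinear X Y X' Y').

Lemma zeta_alg_bilin (X Y X' Y' : Algebra T) :
  und (zeta_alg X Y X' Y') ∘ b (X ⋆ Y) (X' ⋆ Y')
  = (b X X' [⋆] b Y Y') ∘ zeta D X Y X' Y'.
Proof.
exact (uext_comp P (universal_bilin P u (X ⋆ Y) (X' ⋆ Y')) (zeta_bilinear X Y X' Y')).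
Qed.

Lemma theta_bilinear : multilinear P [JT; JT] JT (theta D).
Proof. apply bilinearE. exact (bm_theta B). Qed.

Definition theta_alg : AlgHom (JT ⋄ JT) JT :=
  uext P (universal_bilin P u JT JT) theta_bilinear.

Lemma theta_alg_bilin : und theta_alg ∘ b JT JT = theta D.
Proof. exact (uext_comp P (universal_bilin P u JT JT) theta_bilinear). Qed.

(** By [mu_psi], [psi S I I] is a morphism out of the free algebra on [star I I], and
    [fmap T (delta D)] is one between free algebras. *)
Lemma delta_act :
  act (TI ⋆ TI) ∘ fmap T (psi S I I ∘ fmap T (delta D))
  = psi S I I ∘ fmap T (delta D) ∘ act TI.
Proof.
simpl.
rewrite fmap_comp. crewrite2 (eq_sym (mu_nat T (delta D))).
now rewrite (comp_assoc (psi S I I)), mu_psi, <- !comp_assoc.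
Qed.

Definition delta_alg : AlgHom TI (TI ⋆ TI) := Build_AlgHom _ T TI (TI ⋆ TI) _ delta_act.

Lemma zeta0_act :
  act JT ∘ fmap T (psi0 S ∘ fmap T (zeta0 D)) = psi0 S ∘ fmap T (zeta0 D) ∘ act TI.
Proof.
simpl.
rewrite fmap_comp. crewrite2 (eq_sym (mu_nat T (zeta0 D))).
now rewrite !comp_assoc, mu_psi0.
Qed.

Definition zeta0_alg : AlgHom TI JT := Build_AlgHom _ T TI JT _ zeta0_act.

Lemma phi0_epi : alg_epi TI (phi0 P).
Proof. exact (universal_epi P (universal_phi0 P)). Qed.

(** * The duoidal axioms for algebras *)

Lemma zeta_alg_natural {X X1 Y Y1 X' X1' Y' Y1' : Algebra T}
  (f : AlgHom X X1) (g : AlgHom Y Y1) (f' : AlgHom X' X1') (g' : AlgHom Y' Y1') :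
  alg_comp _ _ _ (zeta_alg X1 Y1 X1' Y1') ((f ⋆⋆ g) ⋄⋄ (f' ⋆⋆ g'))
  = alg_comp _ _ _ ((f ⋄⋄ f') ⋆⋆ (g ⋄⋄ g')) (zeta_alg X Y X' Y').
Proof.
apply bilin_epi; simpl.
crewrite2 (dia_map_bilin P u (f ⋆⋆ g) (f' ⋆⋆ g')).
crewrite2 (zeta_alg_bilin X1 Y1 X1' Y1').
rewrite zeta_nat.
crewrite2 (zeta_alg_bilin X Y X' Y').
fuse. now rewrite !dia_map_bilin.
Qed.

Lemma zeta_alg_assoc_dia (X X' Y Y' Z Z' : Algebra T) :
  alg_comp _ _ _
    (alg_comp _ _ _ (α X Y Z ⋆⋆ α X' Y' Z') (zeta_alg (X ⋄ Y) (X' ⋄ Y') Z Z'))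
    (zeta_alg X X' Y Y' ⋄⋄ alg_id (Z ⋆ Z'))
  = alg_comp _ _ _
      (alg_comp _ _ _ (zeta_alg X X' (Y ⋄ Z) (Y' ⋄ Z'))
         (alg_id (X ⋆ X') ⋄⋄ zeta_alg Y Y' Z Z'))
      (α (X ⋆ X') (Y ⋆ Y') (Z ⋆ Z')).
Proof.
apply (triple_l_epi P u u_comp); simpl.
crewrite2 (dia_map_bilin P u (zeta_alg X X' Y Y') (alg_id (Z ⋆ Z'))).
fuse. cids.
crewrite2 (zeta_alg_bilin X X' Y Y').
crewrite2 (zeta_alg_bilin (X ⋄ Y) (X' ⋄ Y') Z Z').
(* Writing the identity of [star Z Z'] as a tensor of identities makes naturality of [zeta]
   applicable. *)
rewrite (tmap_comp_l MD), <- (tmap_id MS Z Z').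
crewrite2 (zeta_nat D (b X Y) (b X' Y') (idm Z) (idm Z')).
fuse. rewrite (tmap_id MS Z Z').
crewrite3 (dia_assoc_bilin P u u_comp X Y Z).
crewrite3 (dia_assoc_bilin P u u_comp X' Y' Z').
crewrite3 (dia_assoc_bilin P u u_comp (X ⋆ X') (Y ⋆ Y') (Z ⋆ Z')).
crewrite2 (dia_map_bilin P u (alg_id (X ⋆ X')) (zeta_alg Y Y' Z Z')).
fuse. cids.
crewrite2 (zeta_alg_bilin Y Y' Z Z').
crewrite2 (zeta_alg_bilin X X' (Y ⋄ Z) (Y' ⋄ Z')).
rewrite (tmap_comp_r MD), <- (tmap_id MS X X').
crewrite2 (zeta_nat D (idm X) (idm X') (b Y Z) (b Y' Z')).
rewrite tmap_id.
crewrite3 (eq_sym (zeta_assoc_dia D X X' Y Y' Z Z')).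
now fuse.
Qed.

(** The associator of [star_EM] has that of [MS] as underlying map and the domain is one binary
    product of algebras, so cancelling a single [b] reaches [zeta_assoc_star]. *)
Lemma zeta_alg_assoc_star (X Y Z X' Y' Z' : Algebra T) :
  alg_comp _ _ _
    (alg_comp _ _ _ (assoc (star_EM S) (X ⋄ X') (Y ⋄ Y') (Z ⋄ Z'))
       (zeta_alg X Y X' Y' ⋆⋆ alg_id (Z ⋄ Z')))
    (zeta_alg (X ⋆ Y) Z (X' ⋆ Y') Z')
  = alg_comp _ _ _
      (alg_comp _ _ _ (alg_id (X ⋄ X') ⋆⋆ zeta_alg Y Z Y' Z')
         (zeta_alg X (Y ⋆ Z) X' (Y' ⋆ Z')))
      (assoc (star_EM S) X Y Z ⋄⋄ assoc (star_EM S) X' Y' Z').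
Proof.
apply bilin_epi; simpl.
crewrite2 (dia_map_bilin P u (assoc (star_EM S) X Y Z) (assoc (star_EM S) X' Y' Z')).
crewrite2 (zeta_alg_bilin (X ⋆ Y) Z (X' ⋆ Y') Z').
crewrite2 (zeta_alg_bilin X (Y ⋆ Z) X' (Y' ⋆ Z')).
fuse. cids.
crewrite2 (zeta_alg_bilin X Y X' Y').
crewrite2 (zeta_alg_bilin Y Z Y' Z').
rewrite (tmap_comp_l MS), (tmap_comp_r MS).
crewrite2 (assoc_nat MS (b X X') (b Y Y') (b Z Z')).
crewrite3 (zeta_assoc_star D X Y Z X' Y' Z').
reflexivity.
Qed.

Lemma zeta_alg_delta_l (X Y : Algebra T) :
  alg_comp _ _ _
    (alg_comp _ _ _ (dia_lunit P u u_comp X ⋆⋆ dia_lunit P u u_comp Y)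
       (zeta_alg TI TI X Y))
    (delta_alg ⋄⋄ alg_id (X ⋆ Y))
  = dia_lunit P u u_comp (X ⋆ Y).
Proof.
apply (unit_l_epi P u u_comp); simpl.
crewrite3 (dia_lunit_bilin P u u_comp (X ⋆ Y)).
crewrite2 (dia_map_bilin P u delta_alg (alg_id (X ⋆ Y))).
fuse. cids.
(* On [phi0] the map [delta_alg] becomes [(phi0 P [⋆] phi0 P) ∘ delta D]; naturality of [zeta] then
   moves one [phi0] into each unitor. *)
crewrite3 (bm_delta B).
crewrite2 (zeta_alg_bilin TI TI X Y).
rewrite (tmap_comp_l MD), <- (tmap_id MS X Y).
crewrite2 (zeta_nat D (phi0 P) (phi0 P) (idm X) (idm Y)).
fuse.
crewrite3 (dia_lunit_bilin P u u_comp X).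
crewrite3 (dia_lunit_bilin P u u_comp Y).
rewrite tmap_id.
crewrite3 (zeta_delta_l D X Y).
reflexivity.
Qed.

Lemma zeta_alg_delta_r (X Y : Algebra T) :
  alg_comp _ _ _
    (alg_comp _ _ _ (dia_runit P u u_comp X ⋆⋆ dia_runit P u u_comp Y)
       (zeta_alg X Y TI TI))
    (alg_id (X ⋆ Y) ⋄⋄ delta_alg)
  = dia_runit P u u_comp (X ⋆ Y).
Proof.
apply (unit_r_epi P u u_comp); simpl.
crewrite3 (dia_runit_bilin P u u_comp (X ⋆ Y)).
crewrite2 (dia_map_bilin P u (alg_id (X ⋆ Y)) delta_alg).
fuse. cids.
crewrite3 (bm_delta B).
crewrite2 (zeta_alg_bilin X Y TI TI).
rewrite (tmap_comp_r MD), <- (tmap_id MS X Y).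
crewrite2 (zeta_nat D (idm X) (idm Y) (phi0 P) (phi0 P)).
fuse.
crewrite3 (dia_runit_bilin P u u_comp X).
crewrite3 (dia_runit_bilin P u u_comp Y).
rewrite tmap_id.
crewrite3 (zeta_delta_r D X Y).
reflexivity.
Qed.

Lemma zeta_alg_theta_l (X Y : Algebra T) :
  alg_comp _ _ _
    (alg_comp _ _ _ (lunit (star_EM S) (X ⋄ Y)) (theta_alg ⋆⋆ alg_id (X ⋄ Y)))
    (zeta_alg JT X JT Y)
  = lunit (star_EM S) X ⋄⋄ lunit (star_EM S) Y.
Proof.
apply bilin_epi; simpl.
crewrite2 (dia_map_bilin P u (lunit (star_EM S) X) (lunit (star_EM S) Y)).
crewrite2 (zeta_alg_bilin JT X JT Y).
fuse. cids.
crewrite2 theta_alg_bilin.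
rewrite <- (zeta_theta_l D X Y).
crewrite2 (eq_sym (lunit_nat MS (b X Y))).
fuse. now cids.
Qed.

Lemma zeta_alg_theta_r (X Y : Algebra T) :
  alg_comp _ _ _
    (alg_comp _ _ _ (runit (star_EM S) (X ⋄ Y)) (alg_id (X ⋄ Y) ⋆⋆ theta_alg))
    (zeta_alg X JT Y JT)
  = runit (star_EM S) X ⋄⋄ runit (star_EM S) Y.
Proof.
apply bilin_epi; simpl.
crewrite2 (dia_map_bilin P u (runit (star_EM S) X) (runit (star_EM S) Y)).
crewrite2 (zeta_alg_bilin X JT Y JT).
fuse. cids.
crewrite2 theta_alg_bilin.
rewrite <- (zeta_theta_r D X Y).
crewrite2 (eq_sym (runit_nat MS (b X Y))).
fuse. now cids.
Qed.

(** Restricted to [C], [theta_alg] becomes [theta D] and, by [bm_zeta0], [zeta0_alg] becomes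
    [zeta0 D]; each law is then the one for [J]. *)
Lemma J_alg_monoid : is_monoid (dia_EM P u u_comp) JT theta_alg zeta0_alg.
Proof.
constructor; simpl.
- apply (triple_l_epi P u u_comp); simpl.
  crewrite2 (dia_map_bilin P u theta_alg (alg_id JT)).
  fuse. cids.
  crewrite2 theta_alg_bilin. crewrite2 theta_alg_bilin.
  crewrite3 (dia_assoc_bilin P u u_comp JT JT JT).
  crewrite2 (dia_map_bilin P u (alg_id JT) theta_alg).
  fuse. cids.
  crewrite2 theta_alg_bilin. crewrite2 theta_alg_bilin.
  rewrite comp_assoc. apply (J_monoid D).
- apply (unit_l_epi P u u_comp); simpl.
  crewrite3 (dia_lunit_bilin P u u_comp JT).
  crewrite2 (dia_map_bilin P u zeta0_alg (alg_id JT)).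
  fuse. cids.
  crewrite3 (bm_zeta0 B). crewrite2 theta_alg_bilin.
  apply (J_monoid D).
- apply (unit_r_epi P u u_comp); simpl.
  crewrite3 (dia_runit_bilin P u u_comp JT).
  crewrite2 (dia_map_bilin P u (alg_id JT) zeta0_alg).
  fuse. cids.
  crewrite3 (bm_zeta0 B). crewrite2 theta_alg_bilin.
  apply (J_monoid D).
Qed.

(** Morphisms out of the free algebra are tested on [phi0], where [bm_delta] and [bm_zeta0] reduce
    each law to the comonoid law of [I]. *)
Lemma free_unit_comonoid : is_comonoid (star_EM S) TI delta_alg zeta0_alg.
Proof.
destruct (I_comonoid D) as [Hassoc Hl Hr].
constructor; simpl; apply phi0_epi; simpl; rewrite <- ?comp_assoc.
- crewrite3 (bm_delta B). fuse. cids. crewrite3 (bm_delta B).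
  rewrite (tmap_comp_l MS), (tmap_comp_r MS).
  crewrite2 (assoc_nat MS (phi0 P) (phi0 P) (phi0 P)). crewrite3 Hassoc.
  reflexivity.
- crewrite3 (bm_delta B). fuse. cids. crewrite3 (bm_zeta0 B).
  (* Interchange puts [zeta0 D] before [phi0 P], so that [phi0 P] leaves through naturality of the
     unitor and the counit law remains. *)
  rewrite <- (comp_id_l (zeta0 D)), <- (comp_id_r (phi0 P)), tmap_comp.
  crewrite2 (lunit_nat MS (phi0 P)). crewrite3 Hl. now cids.
- crewrite3 (bm_delta B). fuse. cids. crewrite3 (bm_zeta0 B).
  rewrite <- (comp_id_l (zeta0 D)), <- (comp_id_r (phi0 P)), tmap_comp.
  crewrite2 (runit_nat MS (phi0 P)). crewrite3 Hr. now cids.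
Qed.

Definition duoidal_EM : Duoidal (dia_EM P u u_comp) (star_EM S) :=
  Build_Duoidal (dia_EM P u u_comp) (star_EM S)
    zeta_alg delta_alg theta_alg zeta0_alg
    (fun X X1 Y Y1 X' X1' Y' Y1' f g f' g' => zeta_alg_natural f g f' g')
    zeta_alg_assoc_dia zeta_alg_assoc_star zeta_alg_delta_l zeta_alg_delta_r
    zeta_alg_theta_l zeta_alg_theta_r J_alg_monoid free_unit_comonoid.
End DuoidalAlgebras.

Theorem theorem5p3 (C : Category)
  (dia : C -> C -> C) (I : C) (MD : Monoidal dia I)
  (star : C -> C -> C) (J : C) (MS : Monoidal star J)
  (D : Duoidal MD MS) (T : Monad C) (B : BimonoidalMonad D T)
  (u : forall l : list (Algebra T), UniversalMap (bm_phi B) l)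
  (u_comp : universal_closed_under_composition (bm_phi B)) :
  exists (MDT : Monoidal (C := EM T) (dia_alg u) (free_alg T I))
         (DT : Duoidal MDT (star_EM (bm_psi B))),
    is_induced u MDT
    /\ (forall A1 A2 A3 A4 : Algebra T,
          und (zeta DT A1 A2 A3 A4)
            ∘ bilin u (star_alg (bm_psi B) A1 A2) (star_alg (bm_psi B) A3 A4)
          = (bilin u A1 A3 ⊗[MS] bilin u A2 A4) ∘ zeta D A1 A2 A3 A4)
    /\ und (theta DT) ∘ bilin u (J_alg (bm_psi B)) (J_alg (bm_psi B)) = theta D
    /\ und (delta DT) = psi (bm_psi B) I I ∘ fmap T (delta D)
    /\ und (zeta0 DT) = psi0 (bm_psi B) ∘ fmap T (zeta0 D).
Proof.
exists (dia_EM (bm_phi B) u u_comp), (duoidal_EM D B u u_comp).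
split; [|split; [|split; [|split; reflexivity]]].
- apply dia_EM_induced.
- exact (zeta_alg_bilin D B u).
- exact (theta_alg_bilin D B u).
Qed.
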